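(* Suppose $f$ is continuous on $[-1,1]$ and the Legendre polynomials constitute the basis for the space $\mathbb P_L$ of polynomials of degree at most $L$. Let $\lambda\ge0$ and let $0\le\mu_0\le\mu_1\le\cdots$ be the penalization parameters. Then the Lebesgue constants $\Lambda_L$ for the $\ell_2$-regularized least squares approximation of degree $L$ ($L\ge 2$) on $[-1,1]$ using Legendre polynomials satisfy $$\Lambda_L\le\frac{1}{1+\lambda\underline\mu^2}\left(\frac{2^{3/2}}{\sqrt\pi}L^{1/2}+o(L^{1/2})\right)\qquad (L\to\infty),$$ where $\underline\mu=\min\{\mu_0,\mu_1,\dots,\mu_L\}$.
   Context: Let $P_\ell$ denote the Legendre polynomial of degree $\ell$ (normalized by $P_\ell(1)=1$). The Lebesgue constants for the $\ell_2$-regularized approximation using Legendre polynomials are defined as $$\Lambda_L:=\frac12\int_{-1}^1|K_L(x)|\,dx,\qquad K_L(x):=\sum_{\ell=0}^L\frac{2\ell+1}{1+\lambda\mu_\ell^2}P_\ell(x).$$ Here $\lambda$ is the regularization parameter and $\{\mu_\ell\}$ is a nonnegative nondecreasing sequence. *)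

(* Defs.v *)
From Stdlib Require Import Reals Lra.
From Coquelicot Require Import Coquelicot.
Open Scope R_scope.

(* Bonnet's recurrence:
   (m + 1) P_(m+1)(x) = (2 m + 1) x P_m(x) - m P_(m-1)(x). *)
Fixpoint legendre (n : nat) (x : R) : R :=
  match n with
  | O => 1
  | S O => x
  | S (S k as m) =>
      ((2 * INR m + 1) * x * legendre m x - INR m * legendre k x) / INR (S m)
  end.

Lemma legendre_at_1 (n : nat) : legendre n 1 = 1.
Proof.
enough (H : legendre n 1 = 1 /\ legendre (S n) 1 = 1) by exact (proj1 H).
induction n as [|n [IH0 IH1]]; [split; reflexivity|].
split; [exact IH1|].
change (((2 * INR (S n) + 1) * 1 * legendre (S n) 1 - INR (S n) * legendre n 1)
        / INR (S (S n)) = 1).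
rewrite IH0, IH1, (S_INR (S n)).
pose proof (pos_INR (S n)).
field; lra.
Qed.

Definition kernel (lambda : R) (mu : nat -> R) (L : nat) (x : R) : R :=
  sum_f_R0
    (fun l => (2 * INR l + 1) / (1 + lambda * (mu l) ^ 2) * legendre l x) L.

Definition lebesgue_constant (lambda : R) (mu : nat -> R) (L : nat) : R :=
  / 2 * RInt (fun x => Rabs (kernel lambda mu L x)) (-1) 1.

Fixpoint min_upto (u : nat -> R) (n : nat) : R :=
  match n with
  | O => u O
  | S m => Rmin (min_upto u m) (u n)
  end.

(* Main.v *)
Require Import Defs.
From Stdlib Require Import Reals Lra Lia ZArith.
From Coquelicot Require Import Coquelicot.
Open Scope R_scope.

(** Write [K_L] for the unfiltered kernel, the sum of [(2l+1) P_l] over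
    [l <= L], and [c_l = 1/(1 + lambda mu_l^2)].  Since [c_l] decreases,
    summation by parts expresses the filtered kernel as a nonnegative
    combination, of total weight [c_0], of [K_0], ..., [K_L]
    ([lebesgue_constant_abel]).  As the minimum of the [mu_l] is [mu_0], it is
    enough to bound half the integral of [|K_L|] by
    [(2^(3/2)/sqrt PI + eps) sqrt L + C_eps] for each [eps > 0]
    ([unweighted_asymptotics]).

    Put [N = L+1], [T = P_L + P_(L+1)] and [x = cos t].  The pair [(K_L, T)]
    solves the first order system [T' = K_L],
    [(1-x^2) K_L' = (1+x) K_L - N^2 T].  With [g = sqrt (cot (t/2))], the
    functions [p = sin t K_L / (N g)] and [r = T / g] of the angle [t] satisfy
    [p' = N r - p/(2 sin t)] and [r' = -N p + r/(2 sin t)]: the plane point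
    [(p, r)] turns at speed [N] up to a perturbation of size [1/sin t]
    ([legendre_oscillator]), and the integral of [|K_L|] over [[-1,1]] is [N]
    times the integral of [g |p|] over [[0,PI]].

    An almost conserved energy keeps [p^2 + r^2] below a constant multiple of
    its value at the equator [t = PI/2] as long as [N sin t >= 1]
    ([oscillator_energy]).  On a fixed interval [[d, PI-d]] a near-identity change
    of variables removes the perturbation up to [O(1/N)], so that [p] is a
    sinusoid of frequency [N] up to a relative error [O(1/N)]
    ([oscillator_phase]).  At the equator one of [P_L], [P_(L+1)] vanishes and
    Wallis' product bounds the other, so the amplitude of that sinusoid is at most
    [2/sqrt (PI L)].  The mean of [|sin|] is [2/PI] and the integral of [g] is
    [sqrt 2 PI]; so the interval [[d, PI-d]] contributes
    [1/2 N (2/sqrt (PI L)) (2/PI) (sqrt 2 PI)] to half the integral, which is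
    asymptotic to [2^(3/2)/sqrt PI sqrt L].

    Near the ends, the energy bound gives a contribution
    [O(sqrt (d L))] as long as [N t >= 2] and [N (PI - t) >= 2], and the
    pointwise bound [|sin t K_L (cos t)| <= 2N] gives [O(1)] on what remains. *)

(** * The unfiltered kernel and its differential equation *)

Lemma legendre_bonnet (n : nat) (x : R) :
  INR (S (S n)) * legendre (S (S n)) x =
  (2 * INR (S n) + 1) * x * legendre (S n) x - INR (S n) * legendre n x.
Proof.
change (legendre (S (S n)) x) with
  (((2 * INR (S n) + 1) * x * legendre (S n) x - INR (S n) * legendre n x)
   / INR (S (S n))).
field; apply not_0_INR; discriminate.
Qed.

Definition legendre_kernel (L : nat) (x : R) : R :=
  sum_f_R0 (fun l => (2 * INR l + 1) * legendre l x) L.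

Lemma christoffel_darboux (L : nat) (x : R) :
  (1 - x) * legendre_kernel L x =
  INR (S L) * (legendre L x - legendre (S L) x).
Proof.
induction L as [|L IH].
- unfold legendre_kernel; simpl; ring.
- unfold legendre_kernel in *; rewrite tech5, Rmult_plus_distr_l, IH.
  pose proof (legendre_bonnet L x) as B.
  rewrite (Rmult_minus_distr_l (INR (S (S L)))), B, (S_INR (S L)). ring.
Qed.

(** Derivatives of the Legendre polynomials, from
    [P_n' + P_(n+1)' = K_n]. *)
Fixpoint dlegendre (n : nat) (x : R) : R :=
  match n with
  | O => 0
  | S m => legendre_kernel m x - dlegendre m x
  end.

(** Bonnet's recurrence alone only yields a derivative mixing three degrees.
    Carrying the two contiguity relations along the induction is what turns
    the differentiated recurrence back into [dlegendre]. *)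
Lemma dlegendre_spec (n : nat) (x : R) :
  is_derive (legendre n) x (dlegendre n x) /\
  is_derive (legendre (S n)) x (dlegendre (S n) x) /\
  x * dlegendre (S n) x - dlegendre n x = INR (S n) * legendre (S n) x /\
  dlegendre (S n) x - x * dlegendre n x = INR (S n) * legendre n x.
Proof.
induction n as [|n (H0 & H1 & J & K)].
- refine (conj _ (conj _ (conj _ _))).
  + apply @is_derive_const.
  + simpl; unfold legendre_kernel; simpl.
    replace (_ - 0) with 1 by ring. apply @is_derive_id.
  + simpl; unfold legendre_kernel; simpl; ring.
  + simpl; unfold legendre_kernel; simpl; ring.
- pose proof (legendre_bonnet n x) as B.
  assert (E : dlegendre (S (S n)) x =
              dlegendre n x + (2 * INR (S n) + 1) * legendre (S n) x).
  { change (dlegendre (S (S n)) x) with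
      (legendre_kernel (S n) x - (legendre_kernel n x - dlegendre n x)).
    unfold legendre_kernel; rewrite tech5; ring. }
  assert (P2 : 0 < INR (S (S n))) by (apply lt_0_INR; lia).
  assert (E2 : INR (S (S n)) = INR (S n) + 1) by apply S_INR.
  refine (conj _ (conj _ (conj _ _))).
  + exact H1.
  + apply (is_derive_ext (fun y =>
      ((2 * INR (S n) + 1) * y * legendre (S n) y - INR (S n) * legendre n y)
      / INR (S (S n)))); [reflexivity|].
    clear K B. revert J H0 H1 E E2 P2.
    generalize (legendre (S n)) (legendre n) (dlegendre (S (S n)) x)
      (INR (S n)) (INR (S (S n))) (dlegendre n x) (dlegendre (S n) x).
    intros f g d a b u v J H0 H1 E E2 P2.
    auto_derive.
    * split; [|split; [|exact I]]; eexists; eassumption.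
    * rewrite (is_derive_unique _ _ _ H0 : Derive (fun y => g y) x = _).
      rewrite (is_derive_unique _ _ _ H1 : Derive (fun y => f y) x = _).
      rewrite E. apply (Rmult_eq_reg_r (b)); [|lra].
      unfold Rdiv; rewrite Rmult_assoc, Rinv_l, Rmult_1_r by lra.
      rewrite E2.
      replace (u) with (x * v - a * f x) by lra.
      ring.
  + rewrite B, E. 
    replace (dlegendre (S n) x) with (x * dlegendre n x + INR (S n) * legendre n x) in * by lra.
    nra.
  + rewrite E, E2.
    replace (dlegendre n x) with (x * dlegendre (S n) x - INR (S n) * legendre (S n) x) by lra.
    ring.
Qed.

Definition dlegendre_kernel (L : nat) (x : R) : R :=
  sum_f_R0 (fun l => (2 * INR l + 1) * dlegendre l x) L.

Lemma is_derive_legendre (n : nat) (x : R) :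
  is_derive (legendre n) x (dlegendre n x).
Proof. apply dlegendre_spec. Qed.

Lemma is_derive_legendre_kernel (L : nat) (x : R) :
  is_derive (legendre_kernel L) x (dlegendre_kernel L x).
Proof.
apply (is_derive_ext (fun x => sum_n (fun l => (2 * INR l + 1) * legendre l x) L)).
{ intros; apply sum_n_Reals. }
unfold dlegendre_kernel; rewrite <- sum_n_Reals.
apply @is_derive_sum_n; intros k _.
apply (is_derive_scal (legendre k)), is_derive_legendre.
Qed.

(** Up to the factor [1 + x], this is the companion Jacobi polynomial of the
    kernel; the two determine each other through a first order system. *)
Definition legendre_pair (L : nat) (x : R) : R := legendre L x + legendre (S L) x.

Lemma is_derive_legendre_pair (L : nat) (x : R) :
  is_derive (legendre_pair L) x (legendre_kernel L x).
Proof.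
replace (legendre_kernel L x) with (dlegendre L x + dlegendre (S L) x)
  by (simpl; ring).
apply @is_derive_plus; apply is_derive_legendre.
Qed.

(** Differentiate [(1-x) K_L = N (P_L - P_(L+1))] and eliminate the
    derivatives on the right with the sum of the two contiguity relations,
    [(1+x)(P_(L+1)' - P_L') = N (P_L + P_(L+1))]. *)
Lemma legendre_kernel_ode (L : nat) (x : R) :
  (1 - x ^ 2) * dlegendre_kernel L x =
  (1 + x) * legendre_kernel L x - INR (S L) ^ 2 * legendre_pair L x.
Proof.
assert (H : is_derive (fun y => (1 - y) * legendre_kernel L y) x
    (- legendre_kernel L x + (1 - x) * dlegendre_kernel L x)).
{ auto_derive.
  - eexists; apply is_derive_legendre_kernel.
  - rewrite (is_derive_unique _ _ _ (is_derive_legendre_kernel L x)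
             : Derive (fun y => legendre_kernel L y) x = _). ring. }
assert (H' : is_derive (fun y => INR (S L) * (legendre L y - legendre (S L) y)) x
    (INR (S L) * (dlegendre L x - dlegendre (S L) x))).
{ apply is_derive_scal, @is_derive_minus; apply is_derive_legendre. }
assert (E : - legendre_kernel L x + (1 - x) * dlegendre_kernel L x =
            INR (S L) * (dlegendre L x - dlegendre (S L) x)).
{ rewrite <- (is_derive_unique _ _ _ H), <- (is_derive_unique _ _ _ H').
  apply Derive_ext; intros; apply christoffel_darboux. }
destruct (dlegendre_spec L x) as (_ & _ & J & K).
unfold legendre_pair.
replace ((1 - x ^ 2) * dlegendre_kernel L x) with
  ((1 + x) * (- legendre_kernel L x + (1 - x) * dlegendre_kernel L x)
   + (1 + x) * legendre_kernel L x) by ring.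
rewrite E.
set (m := INR (S L)) in *.
replace (m ^ 2 * (legendre L x + legendre (S L) x)) with
  (m * (m * legendre L x + m * legendre (S L) x)) by ring.
rewrite <- J, <- K. ring.
Qed.

(** The function [(1-x^2) K_L^2 + N^2 T^2] has derivative [2 K_L^2], so it is
    largest at [x = 1], where it equals [4 N^2]. *)
Lemma legendre_kernel_bound (L : nat) (x : R) : -1 <= x <= 1 ->
  (1 - x ^ 2) * legendre_kernel L x ^ 2 <= 4 * INR (S L) ^ 2.
Proof.
intros Hx.
assert (Nn : 0 < INR (S L)) by (apply lt_0_INR; lia).
set (h := fun y => (1 - y ^ 2) * legendre_kernel L y ^ 2
                   + INR (S L) ^ 2 * legendre_pair L y ^ 2).
assert (D : forall y, is_derive h y (2 * legendre_kernel L y ^ 2)).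
{ intros y; unfold h.
  pose proof (legendre_kernel_ode L y) as O; revert O; generalize (INR (S L)); intros m O.
  auto_derive.
  - split; [|split; [|exact I]]; eexists;
      [apply is_derive_legendre_kernel|apply is_derive_legendre_pair].
  - rewrite (is_derive_unique _ _ _ (is_derive_legendre_kernel L y)
             : Derive (fun y => legendre_kernel L y) y = _).
    rewrite (is_derive_unique _ _ _ (is_derive_legendre_pair L y)
             : Derive (fun y => legendre_pair L y) y = _).
    set (k := legendre_kernel L y) in *.
    transitivity (- 2 * y * k * k + 2 * k * ((1 - y ^ 2) * dlegendre_kernel L y)
      + 2 * m ^ 2 * legendre_pair L y * k); [ring|].
    rewrite O; ring. }
assert (M : h x <= h 1).
{ destruct (MVT_gen h x 1 (fun y => 2 * legendre_kernel L y ^ 2)) as (c & Hc & E).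
  - intros; apply D.
  - intros y _; apply continuity_pt_filterlim, (ex_derive_continuous h);
      eexists; apply D.
  - assert (0 <= legendre_kernel L c ^ 2) by apply pow2_ge_0. nra. }
unfold h in M.
replace (legendre_pair L 1) with 2 in M
  by (unfold legendre_pair; rewrite !legendre_at_1; ring).
assert (0 <= INR (S L) ^ 2 * legendre_pair L x ^ 2)
  by (apply Rmult_le_pos; apply pow2_ge_0).
lra.
Qed.

(** * The value at the equator *)

Lemma is_derive_continuous (f : R -> R) (x l : R) :
  is_derive f x l -> continuous f x.
Proof. intros H; apply (ex_derive_continuous f); eexists; exact H. Qed.

Definition wallis (n : nat) : R := RInt (fun x => sin x ^ n) 0 (PI / 2).

Lemma is_derive_sin_pow (n : nat) (x : R) :
  is_derive (fun y => sin y ^ n) x (INR n * cos x * sin x ^ pred n).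
Proof. auto_derive; [exact I|ring]. Qed.

Lemma ex_RInt_sin_pow (n : nat) (a b : R) : ex_RInt (fun x => sin x ^ n) a b.
Proof.
apply (@ex_RInt_continuous R_CompleteNormedModule); intros x _.
eapply is_derive_continuous, is_derive_sin_pow.
Qed.

(** Integrate the derivative of [cos x sin^(n+1) x]. *)
Lemma wallis_rec (n : nat) :
  INR (S (S n)) * wallis (S (S n)) = INR (S n) * wallis n.
Proof.
assert (H : is_RInt (fun x => INR (S n) * sin x ^ n - INR (S (S n)) * sin x ^ S (S n))
   0 (PI / 2) (INR (S n) * wallis n - INR (S (S n)) * wallis (S (S n)))).
{ apply @is_RInt_minus; apply @is_RInt_scal; apply (@RInt_correct R_CompleteNormedModule);
    apply ex_RInt_sin_pow. }
assert (H' : is_RInt (fun x => INR (S n) * sin x ^ n - INR (S (S n)) * sin x ^ S (S n))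
   0 (PI / 2) (cos (PI / 2) * sin (PI / 2) ^ S n - cos 0 * sin 0 ^ S n)).
{ apply (is_RInt_derive (fun x => cos x * sin x ^ S n)).
  - intros x _. rewrite (S_INR (S n)). generalize (is_derive_sin_pow (S n) x).
    generalize (INR (S n)); intros m D. simpl pred in D.
    evar_last.
    + apply @is_derive_mult; [apply is_derive_cos|exact D|intros; apply Rmult_comm].
    + unfold plus, mult; simpl.
      replace (cos x * (m * cos x * sin x ^ n)) with (m * (cos x)² * sin x ^ n)
        by (unfold Rsqr; ring).
      rewrite cos2; unfold Rsqr; ring.
  - intros x _. apply @continuous_minus; apply (continuous_scal_r (V := R_NormedModule));
      eapply is_derive_continuous, is_derive_sin_pow. }
pose proof (is_RInt_unique _ _ _ _ H) as E. rewrite (is_RInt_unique _ _ _ _ H') in E.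
rewrite cos_PI2, sin_0 in E. simpl in E. simpl. lra.
Qed.

Lemma wallis_decreasing (n : nat) : 0 <= wallis (S n) <= wallis n.
Proof.
pose proof PI_RGT_0.
assert (S01 : forall x, 0 < x < PI / 2 -> 0 <= sin x <= 1).
{ intros x Hx; split; [apply sin_ge_0; lra|apply SIN_bound]. }
split.
- apply RInt_ge_0; [lra|apply ex_RInt_sin_pow|].
  intros x Hx; apply pow_le, S01, Hx.
- apply RInt_le; [lra|apply ex_RInt_sin_pow|apply ex_RInt_sin_pow|].
  intros x Hx; destruct (S01 x Hx); simpl.
  pose proof (pow_le (sin x) n H0). nra.
Qed.

Lemma wallis_0 : wallis 0 = PI / 2.
Proof.
unfold wallis; simpl; rewrite RInt_const; unfold scal; simpl; unfold mult; simpl; ring.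
Qed.

Lemma wallis_product (n : nat) :
  INR (S n) * (wallis n * wallis (S n)) = PI / 2.
Proof.
induction n as [|n IH].
- rewrite wallis_0.
  assert (E : wallis 1 = 1).
  { unfold wallis; apply is_RInt_unique.
    evar_last.
    - apply (is_RInt_derive (fun x => - cos x)).
      + intros x _; auto_derive; [exact I|ring].
      + intros x _; eapply is_derive_continuous, is_derive_sin_pow.
    - unfold minus, plus, opp; simpl; rewrite cos_PI2, cos_0; ring. }
  rewrite E; simpl; ring.
- rewrite <- IH.
  transitivity (wallis (S n) * (INR (S (S n)) * wallis (S (S n)))); [ring|].
  rewrite wallis_rec; ring.
Qed.

(** At [x = 0] Bonnet's recurrence has two terms and the ratio of the Wallis
    integrals, while every odd polynomial vanishes there; so the nonzero values
    are, up to sign, [2/PI] times a Wallis integral. *)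
Lemma legendre_0_bound (n : nat) :
  legendre n 0 * legendre (S n) 0 = 0 /\
  Rabs (legendre n 0) <= 2 / PI * wallis n /\
  Rabs (legendre (S n) 0) <= 2 / PI * wallis (S n).
Proof.
pose proof PI_RGT_0.
assert (0 < 2 / PI) by (apply Rdiv_lt_0_compat; lra).
induction n as [|n (Z & H1 & H2)].
- refine (conj _ (conj _ _)); simpl.
  + ring.
  + rewrite Rabs_R1, wallis_0; apply Req_le; field; lra.
  + rewrite Rabs_R0. pose proof (wallis_decreasing 0). nra.
- assert (P : 0 < INR (S (S n))) by (apply lt_0_INR; lia).
  assert (E : legendre (S (S n)) 0 = - (INR (S n) / INR (S (S n)) * legendre n 0)).
  { apply (Rmult_eq_reg_l (INR (S (S n)))); [|lra].
    rewrite legendre_bonnet; field; lra. }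
  refine (conj _ (conj H2 _)).
  + rewrite E. transitivity (- INR (S n) / INR (S (S n)) *
      (legendre n 0 * legendre (S n) 0)); [field; lra|rewrite Z; ring].
  + rewrite E, Rabs_Ropp, Rabs_mult, Rabs_pos_eq
      by (apply Rdiv_le_0_compat; [apply pos_INR|exact P]).
    replace (wallis (S (S n))) with (INR (S n) / INR (S (S n)) * wallis n).
    * rewrite <- Rmult_assoc, (Rmult_comm (2 / PI)), Rmult_assoc.
      apply Rmult_le_compat_l, H1.
      apply Rdiv_le_0_compat; [apply pos_INR|exact P].
    * apply (Rmult_eq_reg_l (INR (S (S n)))); [|lra].
      rewrite wallis_rec; field; lra.
Qed.

(** Only one of the two values is nonzero, and its square is at most
    [(2/PI)^2 I_n I_(n+1)] by monotonicity of the Wallis integrals [I_n],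
    a product which is known exactly. *)
Lemma legendre_0_energy (n : nat) :
  INR (S n) * (legendre (S n) 0 ^ 2 + legendre (S (S n)) 0 ^ 2) <= 2 / PI.
Proof.
pose proof PI_RGT_0.
assert (0 < 2 / PI) by (apply Rdiv_lt_0_compat; lra).
destruct (legendre_0_bound (S n)) as (Z & H1 & H2).
destruct (wallis_decreasing n) as [W0 W1], (wallis_decreasing (S n)) as [W2 W3].
assert (HB : legendre (S n) 0 ^ 2 + legendre (S (S n)) 0 ^ 2 <=
            (2 / PI) ^ 2 * (wallis n * wallis (S n))).
{ assert (A : forall x, Rabs x <= 2 / PI * wallis (S n) ->
     x ^ 2 <= (2 / PI) ^ 2 * (wallis n * wallis (S n))).
  { intros x Hx. rewrite <- pow2_abs. pose proof (Rabs_pos x).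
    apply Rle_trans with ((2 / PI * wallis (S n)) ^ 2); [apply pow_incr; lra|].
    rewrite Rpow_mult_distr. apply Rmult_le_compat_l; [apply pow2_ge_0|nra]. }
  apply Rmult_integral in Z; destruct Z as [Z|Z]; rewrite Z.
  - rewrite pow_i, Rplus_0_l by lia. apply A. nra.
  - rewrite pow_i, Rplus_0_r by lia. apply A, H1. }
apply Rle_trans with (INR (S n) * ((2 / PI) ^ 2 * (wallis n * wallis (S n)))).
- apply Rmult_le_compat_l; [apply pos_INR|exact HB].
- apply Req_le.
  transitivity ((2 / PI) ^ 2 * (INR (S n) * (wallis n * wallis (S n)))); [ring|].
  rewrite wallis_product; field; lra.
Qed.

(** * Perturbed rotations *)

Definition oscillator (N : R) (p r : R -> R) : Prop :=
  forall t, 0 < t < PI ->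
    is_derive p t (N * r t - p t / (2 * sin t)) /\
    is_derive r t (- N * p t + r t / (2 * sin t)).

Lemma nondecreasing_of_derive (f df : R -> R) (a b : R) : a <= b ->
  (forall t, a <= t <= b -> is_derive f t (df t) /\ 0 <= df t) -> f a <= f b.
Proof.
intros Hab H.
destruct (MVT_gen f a b df) as (c & Hc & E);
  rewrite ?Rmin_left, ?Rmax_right in * by exact Hab.
- intros t Ht; apply H; lra.
- intros t Ht; apply continuity_pt_filterlim; exact (is_derive_continuous _ _ _ (proj1 (H t Ht))).
- pose proof (proj2 (H c Hc)). nra.
Qed.

Lemma sin_between (t u : R) : 0 < t < PI ->
  (t <= u <= PI / 2 \/ PI / 2 <= u <= t) -> sin t <= sin u.
Proof.
intros Ht [Hu|Hu].
- apply sin_incr_1; lra.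
- apply sin_decr_1; lra.
Qed.

(** The derivative of [p^2 + r^2] is [(r^2 - p^2)/sin t], which is not small, but
    [(p r)' = N (r^2 - p^2)] shows that it oscillates.  Subtracting
    [p r / (N sin t)] leaves [p r cos t / (N sin^2 t)], which the factor
    [exp (- 1/(N sin t))] dominates: the corrected energy increases up to [PI/2]
    and decreases afterwards.  While [N sin t >= 1] the correction costs a
    factor 2 at [t] and 3/2 at [PI/2], and the exponential a factor 3. *)
Lemma oscillator_energy (N : R) (p r : R -> R) (t : R) :
  oscillator N p r -> 0 < t < PI -> 1 <= N * sin t -> 1 <= N ->
  p t ^ 2 + r t ^ 2 <= 9 * (p (PI / 2) ^ 2 + r (PI / 2) ^ 2).
Proof.
intros O Ht Hs HN.
set (E := fun u => (p u ^ 2 + r u ^ 2 - p u * r u / (N * sin u)) *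
                   exp (- / (N * sin u))).
set (e := fun u => p u ^ 2 + r u ^ 2 + (1 - / (N * sin u)) * (p u * r u)).
assert (D : forall u, 0 < u < PI ->
  is_derive E u (cos u * (/ (N * sin u ^ 2) * exp (- / (N * sin u)) * e u))).
{ intros u Hu. destruct (O u Hu) as [Dp Dr].
  assert (0 < sin u) by (apply sin_gt_0; lra).
  assert (N * sin u <> 0) by (apply Rmult_integral_contrapositive; lra).
  unfold E, e. auto_derive.
  - repeat split; try assumption; eexists; eassumption.
  - rewrite (is_derive_unique _ _ _ Dp : Derive (fun u => p u) u = _).
    rewrite (is_derive_unique _ _ _ Dr : Derive (fun u => r u) u = _).
    field; split; lra. }
assert (P : forall u, 0 < u < PI -> 1 <= N * sin u ->
  0 <= / (N * sin u ^ 2) * exp (- / (N * sin u)) * e u).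
{ intros u Hu Hs'.
  assert (0 < sin u) by (apply sin_gt_0; lra).
  apply Rmult_le_pos; [apply Rmult_le_pos|].
  - apply Rlt_le, Rinv_0_lt_compat, Rmult_lt_0_compat; [lra|apply pow_lt; lra].
  - apply Rlt_le, exp_pos.
  - unfold e. assert (0 < / (N * sin u) <= 1).
    { split; [apply Rinv_0_lt_compat; lra|].
      rewrite <- Rinv_1; apply Rinv_le_contravar; lra. }
    set (k := 1 - _); assert (0 <= k <= 1) by (unfold k; lra).
    assert (0 <= (p u + r u) ^ 2) by apply pow2_ge_0.
    pose proof (pow2_ge_0 (p u)); pose proof (pow2_ge_0 (r u)). nra. }
pose proof PI_RGT_0.
assert (M : E t <= E (PI / 2)).
{ destruct (Rle_or_lt t (PI / 2)) as [Hl|Hl].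
  - refine (nondecreasing_of_derive _ _ _ _ Hl _). intros u Hu; split; [apply D; lra|].
    apply Rmult_le_pos; [apply cos_ge_0; lra|apply P; [lra|]].
    assert (sin t <= sin u) by (apply sin_between; lra). nra.
  - apply Ropp_le_cancel.
    refine (nondecreasing_of_derive (fun u => - E u) _ _ _ (Rlt_le _ _ Hl) _).
    intros u Hu; split; [apply @is_derive_opp, D; lra|].
    unfold opp; simpl. rewrite <- Ropp_mult_distr_l_reverse.
    apply Rmult_le_pos; [|apply P; [lra|]].
    + assert (cos u <= 0) by (apply cos_le_0; lra). lra.
    + assert (sin t <= sin u) by (apply sin_between; lra). nra. }
unfold E in M. rewrite sin_PI2, Rmult_1_r in M.
assert (I1 : 0 < / (N * sin t) <= 1).
{ split; [apply Rinv_0_lt_compat; lra|].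
  rewrite <- Rinv_1; apply Rinv_le_contravar; lra. }
assert (I2 : 0 < / N <= 1).
{ split; [apply Rinv_0_lt_compat; lra|].
  rewrite <- Rinv_1; apply Rinv_le_contravar; lra. }
unfold Rdiv in M.
set (k := / (N * sin t)) in *; set (m := / N) in *.
set (a := p t) in *; set (b := r t) in *.
set (a0 := p (PI / 2)) in *; set (b0 := r (PI / 2)) in *.
assert (X0 : / 3 <= exp (- k)).
{ rewrite exp_Ropp. apply Rinv_le_contravar; [apply exp_pos|].
  apply Rle_trans with (exp 1); [|apply exp_le_3].
  destruct (Rle_lt_or_eq_dec _ _ (proj2 I1)) as [J|J];
    [apply Rlt_le, exp_increasing, J|rewrite J; lra]. }
assert (X1 : exp (- m) <= 1).
{ rewrite <- exp_0; apply Rlt_le, exp_increasing; lra. }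
assert (L1 : (a ^ 2 + b ^ 2) / 2 <= a ^ 2 + b ^ 2 - a * b * k).
{ assert (0 <= (a - b) ^ 2) by apply pow2_ge_0.
  pose proof (pow2_ge_0 a); pose proof (pow2_ge_0 b). nra. }
assert (L2 : a0 ^ 2 + b0 ^ 2 - a0 * b0 * m <= 3 / 2 * (a0 ^ 2 + b0 ^ 2)).
{ assert (0 <= (a0 + b0) ^ 2) by apply pow2_ge_0.
  pose proof (pow2_ge_0 a0); pose proof (pow2_ge_0 b0). nra. }
pose proof (exp_pos (- m)).
assert (0 <= a ^ 2 + b ^ 2) by (pose proof (pow2_ge_0 a); pose proof (pow2_ge_0 b); lra).
assert (0 <= a0 ^ 2 + b0 ^ 2)
  by (pose proof (pow2_ge_0 a0); pose proof (pow2_ge_0 b0); lra).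
assert (U1 : (a ^ 2 + b ^ 2) / 2 * / 3 <= (a ^ 2 + b ^ 2 - a * b * k) * exp (- k))
  by (apply Rmult_le_compat; lra).
assert (U2 : (a0 ^ 2 + b0 ^ 2 - a0 * b0 * m) * exp (- m) <=
             3 / 2 * (a0 ^ 2 + b0 ^ 2) * 1).
{ apply Rmult_le_compat; try lra.
  assert (0 <= (a0 - b0) ^ 2) by apply pow2_ge_0.
  pose proof (pow2_ge_0 a0); pose proof (pow2_ge_0 b0). nra. }
pose proof (Rle_trans _ _ _ U1 (Rle_trans _ _ _ M U2)). lra.
Qed.

(** The variables [p - k r] and [r - k p] with [k = 1/(4 N sin t)] rotate at
    speed [N] up to [O(1/N)]: this [k] is chosen to cancel the terms in
    [1/(2 sin t)].  Rotating them back from time [u] to the fixed time [t] gives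
    a function [e] of [u] with [e' = O(1/N)]; compare [u = t] and [u = PI/2]. *)
Lemma oscillator_phase (N M d t : R) (p r : R -> R) :
  oscillator N p r -> 0 < N -> 0 < d -> d <= t <= PI - d ->
  (forall u, d <= u <= PI - d -> Rabs (p u) <= M /\ Rabs (r u) <= M) ->
  Rabs (p t - (p (PI / 2) * cos (N * (t - PI / 2)) +
               r (PI / 2) * sin (N * (t - PI / 2)))) <= 3 * M / (N * sin d ^ 2).
Proof.
intros O HN Hd Ht B.
pose proof PI_RGT_0; pose proof PI_4.
assert (Sd : 0 < sin d <= 1) by (split; [apply sin_gt_0; lra|apply SIN_bound]).
assert (Su : forall u, d <= u <= PI - d -> sin d <= sin u).
{ intros u Hu; destruct (Rle_or_lt u (PI / 2)).
  - apply sin_incr_1; lra.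
  - rewrite <- (sin_PI_x u). apply sin_incr_1; lra. }
assert (M0 : 0 <= M).
{ eapply Rle_trans; [apply Rabs_pos|exact (proj1 (B t Ht))]. }
set (Q := / (N * sin d ^ 2)).
assert (S2 : forall u, d <= u <= PI - d -> 0 < / (N * sin u ^ 2) <= Q).
{ intros u Hu; pose proof (Su u Hu).
  assert (0 < sin d ^ 2) by (apply pow_lt; lra).
  assert (sin d ^ 2 <= sin u ^ 2) by (apply pow_incr; lra).
  split; [apply Rinv_0_lt_compat|apply Rinv_le_contravar]; nra. }
assert (K : forall u, d <= u <= PI - d -> 0 < / (4 * N * sin u) <= / 4 * Q).
{ intros u Hu; pose proof (Su u Hu). destruct (SIN_bound u).
  assert (U : 0 < sin u ^ 2 <= sin u) by nra.
  replace (/ (4 * N * sin u)) with (/ 4 * / (N * sin u)) by (field; lra).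
  destruct (S2 u Hu).
  assert (0 < / (N * sin u)) by (apply Rinv_0_lt_compat; nra).
  assert (/ (N * sin u) <= / (N * sin u ^ 2)) by (apply Rinv_le_contravar; nra).
  lra. }
set (e := fun u => (p u - / (4 * N * sin u) * r u) * cos (N * (t - u)) +
                   (r u - / (4 * N * sin u) * p u) * sin (N * (t - u))).
set (de := fun u => / 8 * (/ (N * sin u ^ 2)) *
   ((2 * cos u - 1) * r u * cos (N * (t - u)) +
    (2 * cos u + 1) * p u * sin (N * (t - u)))).
assert (D : forall u, 0 < u < PI -> is_derive e u (de u)).
{ intros u Hu. destruct (O u Hu) as [Dp Dr].
  assert (0 < sin u) by (apply sin_gt_0; lra).
  assert (4 * N * sin u <> 0) by (repeat apply Rmult_integral_contrapositive; split; lra).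
  unfold e, de. auto_derive.
  - repeat split; try assumption; eexists; eassumption.
  - rewrite (is_derive_unique _ _ _ Dp : Derive (fun u => p u) u = _).
    rewrite (is_derive_unique _ _ _ Dr : Derive (fun u => r u) u = _).
    change (t + - u) with (t - u). field; split; lra. }
assert (AB : forall a b x y, Rabs a <= x -> Rabs b <= y -> Rabs (a * b) <= x * y).
{ intros a b x y Ha Hb; rewrite Rabs_mult.
  apply Rmult_le_compat; auto using Rabs_pos. }
assert (AC : forall x, Rabs (cos x) <= 1) by (intros x; apply Rabs_le, COS_bound).
assert (AS : forall x, Rabs (sin x) <= 1) by (intros x; apply Rabs_le, SIN_bound).
assert (DB : forall u, d <= u <= PI - d -> Rabs (de u) <= Q * M).
{ intros u Hu. destruct (B u Hu) as [Bp Br]; destruct (S2 u Hu).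
  unfold de. replace (Q * M) with (/ 8 * Q * (3 * M * 1 + 3 * M * 1 + 2 * M)) by field.
  apply AB.
  - rewrite Rabs_pos_eq; lra.
  - pose proof (COS_bound u).
    eapply Rle_trans; [apply Rabs_triang|].
    assert (Rabs ((2 * cos u - 1) * r u * cos (N * (t - u))) <= 3 * M * 1)
      by (apply AB; [apply AB; [apply Rabs_le; lra|]|]; auto).
    assert (Rabs ((2 * cos u + 1) * p u * sin (N * (t - u))) <= 3 * M * 1)
      by (apply AB; [apply AB; [apply Rabs_le; lra|]|]; auto).
    lra. }
assert (MV : Rabs (e t - e (PI / 2)) <= Q * M * 2).
{ assert (I : forall u, Rmin (PI / 2) t <= u <= Rmax (PI / 2) t -> d <= u <= PI - d).
  { intros u. unfold Rmin, Rmax; destruct (Rle_dec (PI / 2) t); lra. }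
  destruct (MVT_gen e (PI / 2) t de) as (c & Hc & E).
  - intros u Hu; apply D. assert (d <= u <= PI - d) by (apply I; lra). lra.
  - intros u Hu; apply continuity_pt_filterlim; eapply is_derive_continuous, D.
    apply I in Hu; lra.
  - rewrite E. apply AB; [apply DB, I, Hc|apply Rabs_le; lra]. }
assert (Hm : d <= PI / 2 <= PI - d) by lra.
destruct (B t Ht) as [Bp Br]; destruct (B (PI / 2) Hm) as [Bp0 Br0].
pose proof (K t Ht) as Kt; pose proof (K (PI / 2) Hm) as K0.
set (c := cos (N * (t - PI / 2))); set (s := sin (N * (t - PI / 2))).
replace (p t - (p (PI / 2) * c + r (PI / 2) * s)) with
  (e t - e (PI / 2) + / (4 * N * sin t) * r t
   + - (/ (4 * N * sin (PI / 2)) * (r (PI / 2) * c + p (PI / 2) * s))).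
2:{ unfold e; fold c; fold s. replace (N * (t - t)) with 0 by ring.
    rewrite cos_0, sin_0. ring. }
assert (T1 : Rabs (/ (4 * N * sin t) * r t) <= / 4 * Q * M)
  by (apply AB; [rewrite Rabs_pos_eq; lra|exact Br]).
assert (T2 : Rabs (/ (4 * N * sin (PI / 2)) * (r (PI / 2) * c + p (PI / 2) * s))
             <= / 4 * Q * (M * 1 + M * 1)).
{ apply AB; [rewrite Rabs_pos_eq; lra|].
  eapply Rle_trans; [apply Rabs_triang|].
  apply Rplus_le_compat; apply AB; auto; [apply AC|apply AS]. }
eapply Rle_trans; [apply Rabs_triang|].
rewrite Rabs_Ropp.
eapply Rle_trans; [apply Rplus_le_compat_r, Rabs_triang|].
assert (0 <= Q * M) by (destruct (S2 t Ht); nra).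
replace (3 * M / (N * sin d ^ 2)) with (3 * (Q * M)) by (unfold Q; field; split; nra).
lra.
Qed.

(** * Averaging the oscillation *)

(** Primitive of [|sin|] minus its mean value: it is periodic, hence bounded,
    which makes the fast oscillation of [|sin (N t)|] average out. *)
Definition sin_primitive (t : R) : R :=
  RInt (fun s => Rabs (sin s)) 0 t - 2 / PI * t.

Lemma continuous_abs_sin (s : R) : continuous (fun s => Rabs (sin s)) s.
Proof.
apply (continuous_comp sin Rabs); [apply continuous_sin|apply continuous_Rabs].
Qed.

Lemma ex_RInt_abs_sin (a b : R) : ex_RInt (fun s => Rabs (sin s)) a b.
Proof.
apply (@ex_RInt_continuous R_CompleteNormedModule); intros; apply continuous_abs_sin.
Qed.

Lemma RInt_abs_sin_period : RInt (fun s => Rabs (sin s)) 0 PI = 2.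
Proof.
pose proof PI_RGT_0.
apply is_RInt_unique, (is_RInt_ext sin).
- rewrite Rmin_left, Rmax_right by lra.
  intros x Hx; rewrite Rabs_pos_eq; [reflexivity|apply sin_ge_0; lra].
- evar_last.
  + apply (is_RInt_derive (fun x => - cos x)).
    * intros x _; auto_derive; [exact I|ring].
    * intros x _; apply continuous_sin.
  + unfold minus, plus, opp; simpl; rewrite cos_PI, cos_0; ring.
Qed.

Lemma is_derive_sin_primitive (t : R) :
  is_derive sin_primitive t (Rabs (sin t) - 2 / PI).
Proof.
apply @is_derive_minus.
- apply (is_derive_RInt (fun s => Rabs (sin s)) _ 0).
  + apply filter_forall; intros x.
    apply (@RInt_correct R_CompleteNormedModule), ex_RInt_abs_sin.
  + apply continuous_abs_sin.
- auto_derive; [exact I|ring].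
Qed.

Lemma sin_primitive_period (t : R) : sin_primitive (t + PI) = sin_primitive t.
Proof.
pose proof PI_RGT_0.
unfold sin_primitive.
rewrite <- (RInt_Chasles (fun s => Rabs (sin s)) 0 PI (t + PI)) by apply ex_RInt_abs_sin.
replace (RInt (fun s => Rabs (sin s)) PI (t + PI))
  with (RInt (fun s => Rabs (sin s)) 0 t).
- rewrite RInt_abs_sin_period. unfold plus; simpl; field; lra.
- pose proof (RInt_comp_lin (fun s => Rabs (sin s)) 1 PI 0 t
    (ex_RInt_abs_sin _ _)) as E.
  replace (1 * 0 + PI) with PI in E by ring.
  replace (1 * t + PI) with (t + PI) in E by ring.
  rewrite <- E. apply RInt_ext; intros s _.
  unfold scal; simpl; unfold mult; simpl.
  now rewrite !Rmult_1_l, neg_sin, Rabs_Ropp.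
Qed.

Lemma sin_primitive_bound (t : R) : Rabs (sin_primitive t) <= 2.
Proof.
pose proof PI_RGT_0.
assert (Pn : forall n u, sin_primitive (u + INR n * PI) = sin_primitive u).
{ induction n as [|n IH]; intros u.
  - f_equal; simpl; ring.
  - rewrite S_INR, <- (IH u), <- (sin_primitive_period (u + INR n * PI)).
    f_equal; ring. }
assert (Pz : forall k u, sin_primitive (u + IZR k * PI) = sin_primitive u).
{ intros k u. destruct (Z_le_gt_dec 0 k) as [Hk|Hk].
  - destruct (IZN k Hk) as [n ->]. rewrite <- INR_IZR_INZ. apply Pn.
  - destruct (IZN (- k)) as [n Hn]; [lia|].
    rewrite <- (Pn n). f_equal. rewrite INR_IZR_INZ, <- Hn, opp_IZR. ring. }
destruct (base_Int_part (t / PI)) as [B1 B2].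
set (k := Int_part (t / PI)) in *.
rewrite <- (Pz (- k)%Z).
rewrite opp_IZR. set (u := t + - IZR k * PI).
assert (Hu : 0 <= u <= PI).
{ replace u with ((t / PI - IZR k) * PI) by (unfold u; field; lra).
  set (q := t / PI - IZR k). assert (0 <= q <= 1) by (unfold q; lra). nra. }
assert (J : 0 <= RInt (fun s => Rabs (sin s)) 0 u <= 2).
{ split.
  - apply RInt_ge_0; [lra|apply ex_RInt_abs_sin|intros; apply Rabs_pos].
  - rewrite <- RInt_abs_sin_period.
    rewrite <- (RInt_Chasles (fun s => Rabs (sin s)) 0 u PI) by apply ex_RInt_abs_sin.
    assert (0 <= RInt (fun s => Rabs (sin s)) u PI)
      by (apply RInt_ge_0; [lra|apply ex_RInt_abs_sin|intros; apply Rabs_pos]).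
    unfold plus; simpl; lra. }
unfold sin_primitive. apply Rabs_le.
assert (0 <= 2 / PI * u <= 2).
{ split.
  - apply Rmult_le_pos; [apply Rdiv_le_0_compat; lra|lra].
  - apply Rle_trans with (2 / PI * PI); [|apply Req_le; field; lra].
    apply Rmult_le_compat_l; [apply Rdiv_le_0_compat; lra|lra]. }
lra.
Qed.

(** * The polar weight *)

(** This is [sqrt (cot (t/2))], written without half angles. *)
Definition weight (t : R) : R := sqrt ((1 + cos t) / sin t).

Lemma weight_arg_pos (t : R) : 0 < t < PI -> 0 < (1 + cos t) / sin t.
Proof.
intros Ht. assert (0 < sin t) by (apply sin_gt_0; lra).
apply Rdiv_lt_0_compat; [|assumption].
pose proof (sin2_cos2 t) as E; unfold Rsqr in E. pose proof (COS_bound t). nra.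
Qed.

Lemma weight_pos (t : R) : 0 < t < PI -> 0 < weight t.
Proof. intros; apply sqrt_lt_R0, weight_arg_pos; assumption. Qed.

Lemma weight_sqr (t : R) : 0 < t < PI -> weight t * weight t = (1 + cos t) / sin t.
Proof. intros; apply sqrt_sqrt, Rlt_le, weight_arg_pos; assumption. Qed.

Lemma weight_inv_sqr (t : R) :
  0 < t < PI -> / weight t * / weight t = (1 - cos t) / sin t.
Proof.
intros Ht. assert (0 < sin t) by (apply sin_gt_0; lra).
pose proof (weight_arg_pos t Ht) as H0.
rewrite <- Rinv_mult, weight_sqr by assumption.
assert (0 < 1 + cos t).
{ replace (1 + cos t) with ((1 + cos t) / sin t * sin t) by (field; lra). nra. }
assert (H3 : 0 < (1 + cos t) / sin t * sin t ^ 2)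
  by (apply Rmult_lt_0_compat; [assumption|apply pow_lt; assumption]).
apply (Rmult_eq_reg_r ((1 + cos t) / sin t * sin t ^ 2)); [|lra].
pose proof (sin2_cos2 t) as E; unfold Rsqr in E.
transitivity (sin t ^ 2); [field; lra|].
transitivity (1 - cos t * cos t); [lra|field; lra].
Qed.

Lemma is_derive_weight (t : R) :
  0 < t < PI -> is_derive weight t (- weight t / (2 * sin t)).
Proof.
intros Ht. assert (0 < sin t) by (apply sin_gt_0; lra).
pose proof (weight_arg_pos t Ht). pose proof (weight_pos t Ht).
pose proof (weight_sqr t Ht) as W.
unfold weight. auto_derive.
- split; [lra|split; [exact H0|exact I]].
- fold (weight t). 
  replace (sqrt ((1 + cos t) * / sin t)) with (weight t) by reflexivity.
  assert (P : 0 < 2 * weight t * sin t ^ 2)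
    by (apply Rmult_lt_0_compat; [lra|apply pow_lt; assumption]).
  apply (Rmult_eq_reg_r (2 * weight t * sin t ^ 2)); [|lra].
  transitivity (- ((weight t * weight t) * sin t)); [|field; lra].
  rewrite W. pose proof (sin2_cos2 t) as E; unfold Rsqr in E.
  transitivity (- (sin t * sin t + cos t * cos t) - cos t); [field; lra|].
  rewrite E; field; lra.
Qed.

Lemma weight_reflect (t : R) : 0 < t < PI -> weight (PI - t) = / weight t.
Proof.
intros Ht.
pose proof (weight_pos t Ht). assert (Ht' : 0 < PI - t < PI) by lra.
pose proof (weight_pos _ Ht').
assert (0 < / weight t) by (apply Rinv_0_lt_compat; assumption).
apply Rsqr_inj; [lra|lra|]. unfold Rsqr.
rewrite weight_sqr, weight_inv_sqr by assumption.
rewrite sin_PI_x. replace (cos (PI - t)) with (- cos t); [reflexivity|].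
rewrite cos_minus, cos_PI, sin_PI; ring.
Qed.

(** The two summands are primitives of half of [g + 1/g] and of half of
    [g - 1/g]; the substitutions are [z = 1/g - g] and [v = g + 1/g], for which
    [1 + z^2/2] and [(v^2 - 2)/2] both equal [1/sin t]. *)
Definition weight_primitive (t : R) : R :=
  sqrt 2 * atan ((/ weight t - weight t) / sqrt 2) +
  sqrt 2 / 2 * ln ((weight t + / weight t + sqrt 2) / (weight t + / weight t - sqrt 2)).

Lemma is_derive_weight_primitive (t : R) :
  0 < t < PI -> is_derive weight_primitive t (weight t).
Proof.
intros Ht. assert (Sp : 0 < sin t) by (apply sin_gt_0; lra).
pose proof (weight_pos t Ht) as Wp. pose proof (is_derive_weight t Ht) as Dw.
pose proof (weight_sqr t Ht) as W1. pose proof (weight_inv_sqr t Ht) as W2.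
assert (Q : sqrt 2 * sqrt 2 = 2) by (apply sqrt_sqrt; lra).
assert (Qp : 0 < sqrt 2) by (apply sqrt_lt_R0; lra).
assert (V : sqrt 2 < weight t + / weight t).
{ apply Rsqr_incrst_0; [unfold Rsqr; rewrite Q|lra|].
  - assert (weight t * / weight t = 1) by (field; lra).
    assert (0 < / weight t) by (apply Rinv_0_lt_compat; lra). nra.
  - assert (0 < / weight t) by (apply Rinv_0_lt_compat; lra). lra. }
unfold weight_primitive. auto_derive.
- repeat split; try (eexists; exact Dw); try lra.
  apply Rdiv_lt_0_compat; lra.
- rewrite (is_derive_unique _ _ _ Dw : Derive (fun t => weight t) t = _).
  set (w := weight t) in *. set (q := sqrt 2) in *. set (s := sin t) in *.
  assert (S : s * (w ^ 4 + 1) = 2 * w ^ 2).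
  { transitivity (w ^ 2 * s * (w * w + / w * / w)); [field; lra|].
    rewrite W1, W2. field. lra. }
  clearbody w q s. clear W1 W2 Dw.
  assert (Y : s = 2 * w ^ 2 / (w ^ 4 + 1)).
  { rewrite <- S; field. nra. }
  assert (0 < w ^ 4 + 1) by (pose proof (pow_lt w 4 Wp); lra).
  assert (Z : 0 < w * w + 1 - q * w).
  { replace (w * w + 1 - q * w) with (w * (w + / w - q)) by (field; lra). nra. }
  assert (Z' : 0 < w * w + 1 + q * w) by nra.
  assert (T1 : 1 + (/ w + - w) * / q * ((/ w + - w) * / q * 1) = / s).
  { transitivity (1 + (/ w - w) ^ 2 / (q * q)); [field; lra|].
    rewrite Q, Y. field. lra. }
  assert (T2 : (w + / w + q) * (w + / w - q) = 2 / s).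
  { transitivity ((w + / w) ^ 2 - q * q); [ring|].
    rewrite Q, Y. field. lra. }
  rewrite T1.
  transitivity ((w + / w) / 2 +
    q / 2 * ((/ w - w) / (2 * s)) * (- 2 * q) / ((w + / w + q) * (w + / w - q))).
  { field. repeat split; lra. }
  rewrite T2.
  transitivity ((w + / w) / 2 - (q * q) / 4 * (/ w - w)); [field; lra|].
  rewrite Q. field; lra.
Qed.

(** Under [t -> PI - t] the weight [g] becomes [1/g], so the logarithmic part
    of the primitive takes the same value at both ends and only the arctangent
    contributes. *)
Lemma weight_total (d : R) : 0 < d <= PI / 2 ->
  weight_primitive (PI - d) - weight_primitive d <= sqrt 2 * PI.
Proof.
intros Hd. pose proof PI_RGT_0.
assert (Qp : 0 < sqrt 2) by (apply sqrt_lt_R0; lra).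
unfold weight_primitive. rewrite weight_reflect, Rinv_inv by lra.
rewrite (Rplus_comm (/ weight d) (weight d)).
pose proof (atan_bound ((weight d - / weight d) / sqrt 2)).
pose proof (atan_bound ((/ weight d - weight d) / sqrt 2)).
nra.
Qed.

(** Integration by parts in differential form.  The product of the weight and
    the bounded primitive of [|sin| - 2/PI] leaves a remainder containing the
    derivative of the weight, which is negative; shifting the primitive by its
    upper bound 2 gives this remainder a sign. *)
Lemma weight_abs_sin_majorant (N phi t : R) : 0 < N -> 0 < t < PI ->
  exists l, is_derive (fun u => 2 / PI * weight_primitive u +
        / N * (weight u * (sin_primitive (N * u + phi) - 2))) t l /\
    weight t * Rabs (sin (N * t + phi)) <= l.
Proof.
intros HN Ht.
assert (0 < sin t) by (apply sin_gt_0; lra).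
eexists; split.
- apply @is_derive_plus; [apply is_derive_scal, is_derive_weight_primitive, Ht|].
  apply is_derive_scal. apply @is_derive_mult.
  + apply is_derive_weight, Ht.
  + apply @is_derive_minus; [|apply @is_derive_const].
    apply (is_derive_comp sin_primitive (fun u => N * u + phi)).
    * apply is_derive_sin_primitive.
    * auto_derive; [exact I|reflexivity].
  + intros; apply Rmult_comm.
- unfold plus, mult, minus, opp, scal, plus, zero; simpl; unfold mult; simpl.
  pose proof (weight_pos t Ht).
  pose proof (sin_primitive_bound (N * t + phi)) as B. apply Rabs_le_between in B.
  set (F := sin_primitive (N * t + phi)) in *. set (w := weight t) in *.
  set (a := Rabs (sin (N * t + phi))).
  apply Rle_trans with (w * a + / N * (w / (2 * sin t) * (2 - F))).
  + assert (0 <= / N * (w / (2 * sin t) * (2 - F))); [|lra].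
    apply Rmult_le_pos; [apply Rlt_le, Rinv_0_lt_compat, HN|].
    apply Rmult_le_pos; [|lra].
    apply Rdiv_le_0_compat; lra.
  + apply Req_le. pose proof PI_RGT_0. field. repeat split; lra.
Qed.

Lemma RInt_le_primitive (G Phi : R -> R) (a b : R) : a <= b ->
  (forall t, continuous G t) ->
  (forall t, a <= t <= b -> exists l, is_derive Phi t l /\ G t <= l) ->
  RInt G a b <= Phi b - Phi a.
Proof.
intros Hab HG H.
assert (X : forall t, is_derive (RInt G a) t (G t)).
{ intros t; apply (is_derive_RInt G _ a); [|apply HG].
  apply filter_forall; intros x.
  apply (@RInt_correct R_CompleteNormedModule), (@ex_RInt_continuous R_CompleteNormedModule).
  intros; apply HG. }
assert (M : Phi a - RInt G a a <= Phi b - RInt G a b).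
{ apply (nondecreasing_of_derive (fun t => Phi t - RInt G a t)
    (fun t => Derive Phi t - G t)); [exact Hab|].
  intros t Ht. destruct (H t Ht) as (l & D & L).
  rewrite (is_derive_unique _ _ _ D). split; [|lra].
  apply @is_derive_minus; [exact D|apply X]. }
rewrite RInt_point in M. unfold zero in M; simpl in M. lra.
Qed.

(** * The kernel as a perturbed rotation *)

Definition kernel_osc (L : nat) (t : R) : R :=
  sin t * legendre_kernel L (cos t) / (INR (S L) * weight t).
Definition pair_osc (L : nat) (t : R) : R := legendre_pair L (cos t) / weight t.

(** The pair [(sin t K_L / N, T)] already turns at speed [N], but with a damping
    [-1/sin t] of the first component only.  Dividing both components by the
    weight, whose logarithmic derivative is [-1/(2 sin t)], makes the perturbation
    opposite in the two components; it then oscillates instead of accumulating. *)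
Lemma legendre_oscillator (L : nat) :
  oscillator (INR (S L)) (kernel_osc L) (pair_osc L).
Proof.
intros t Ht.
assert (Sp : 0 < sin t) by (apply sin_gt_0; lra).
assert (HN : 0 < INR (S L)) by (apply lt_0_INR; lia).
pose proof (weight_pos t Ht) as Wp. pose proof (is_derive_weight t Ht) as Dw.
pose proof (weight_sqr t Ht) as W1.
pose proof (legendre_kernel_ode L (cos t)) as O.
pose proof (is_derive_legendre_kernel L (cos t)) as Dk.
pose proof (is_derive_legendre_pair L (cos t)) as Dp.
pose proof (sin2_cos2 t) as SC; unfold Rsqr in SC.
unfold kernel_osc, pair_osc. revert HN O; generalize (INR (S L)); intros N HN O.
assert (SCt : 1 - cos t ^ 2 = sin t ^ 2) by (simpl; lra).
rewrite SCt in O.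
split.
- auto_derive.
  + repeat split; try (eexists; first [exact Dw|exact Dk]).
    apply Rmult_integral_contrapositive; lra.
  + rewrite (is_derive_unique _ _ _ Dw : Derive (fun t => weight t) t = _).
    rewrite (is_derive_unique _ _ _ Dk : Derive (fun x => legendre_kernel L x) (cos t) = _).
    set (k := legendre_kernel L (cos t)) in *. set (q := legendre_pair L (cos t)) in *.
    set (w := weight t) in *.
    transitivity ((cos t * k - sin t ^ 2 * dlegendre_kernel L (cos t)) / (N * w) + k / (2 * N * w));
      [field; lra|].
    rewrite O. field; lra.
- auto_derive.
  + repeat split; try (eexists; first [exact Dw|exact Dp]). lra.
  + rewrite (is_derive_unique _ _ _ Dw : Derive (fun t => weight t) t = _).
    rewrite (is_derive_unique _ _ _ Dp : Derive (fun x => legendre_pair L x) (cos t) = _).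
    field; lra.
Qed.

Lemma kernel_osc_eq (L : nat) (t : R) : 0 < t < PI ->
  Rabs (sin t * legendre_kernel L (cos t)) =
  INR (S L) * weight t * Rabs (kernel_osc L t).
Proof.
intros Ht. pose proof (weight_pos t Ht).
assert (HN : 0 < INR (S L)) by (apply lt_0_INR; lia).
rewrite <- (Rabs_pos_eq (INR (S L) * weight t)), <- Rabs_mult by nra.
f_equal. unfold kernel_osc. field. lra.
Qed.

Lemma osc_equator (L : nat) :
  weight (PI / 2) = 1 /\
  kernel_osc L (PI / 2) = legendre L 0 - legendre (S L) 0 /\
  pair_osc L (PI / 2) = legendre L 0 + legendre (S L) 0.
Proof.
assert (HN : 0 < INR (S L)) by (apply lt_0_INR; lia).
assert (W : weight (PI / 2) = 1).
{ unfold weight; rewrite cos_PI2, sin_PI2, Rplus_0_r, Rdiv_1_r; apply sqrt_1. }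
refine (conj W (conj _ _)).
- unfold kernel_osc. rewrite W, sin_PI2, cos_PI2.
  pose proof (christoffel_darboux L 0) as C.
  rewrite Rminus_0_r, Rmult_1_l in C. rewrite C. field; lra.
- unfold pair_osc, legendre_pair. rewrite W, cos_PI2. field.
Qed.

Lemma sin_half (t : R) : 0 <= t <= 1 -> t / 2 <= sin t.
Proof.
intros Ht. pose proof PI2_3_2.
assert (sin 0 - 0 / 2 <= sin t - t / 2); [|rewrite sin_0 in *; lra].
apply (nondecreasing_of_derive (fun u => sin u - u / 2) (fun u => cos u - / 2)); [lra|].
intros u Hu; split; [auto_derive; [exact I|field]|].
assert (cos (PI / 3) <= cos u) by (apply cos_decr_1; lra).
rewrite cos_PI3 in *; lra.
Qed.

Definition equator_amplitude (L : nat) : R :=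
  sqrt (legendre L 0 ^ 2 + legendre (S L) 0 ^ 2).

Lemma equator_amplitude_sqr (L : nat) :
  0 <= equator_amplitude L /\
  equator_amplitude L ^ 2 = legendre L 0 ^ 2 + legendre (S L) 0 ^ 2.
Proof.
split; [apply sqrt_pos|apply pow2_sqrt].
pose proof (pow2_ge_0 (legendre L 0)); pose proof (pow2_ge_0 (legendre (S L) 0)); lra.
Qed.

Lemma kernel_osc_bound (L : nat) (t : R) : 0 < t < PI -> 1 <= INR (S L) * sin t ->
  Rabs (kernel_osc L t) <= 5 * equator_amplitude L /\
  Rabs (pair_osc L t) <= 5 * equator_amplitude L.
Proof.
intros Ht Hs.
destruct (equator_amplitude_sqr L) as [W0 W].
assert (HN : 1 <= INR (S L)) by (rewrite S_INR; pose proof (pos_INR L); lra).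
pose proof (oscillator_energy _ _ _ t (legendre_oscillator L) Ht Hs HN) as E.
destruct (osc_equator L) as (_ & E1 & E2). rewrite E1, E2 in E.
set (w := equator_amplitude L) in *.
pose proof (pow2_ge_0 (kernel_osc L t)); pose proof (pow2_ge_0 (pair_osc L t)).
assert (E3 : kernel_osc L t ^ 2 + pair_osc L t ^ 2 <= (5 * w) ^ 2).
{ pose proof (pow2_ge_0 w).
  replace ((5 * w) ^ 2) with (25 * w ^ 2) by ring. rewrite W in *. lra. }
split; rewrite <- (Rabs_pos_eq (5 * w)) by lra; apply Rsqr_le_abs_0;
  rewrite !Rsqr_pow2; lra.
Qed.

(** As one of the two values vanishes, the coefficients of [cos] and [sin] agree
    up to sign, and the phase is plus or minus [PI/4]. *)
Lemma equator_phase (L : nat) : exists phi, forall s,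
  Rabs ((legendre L 0 - legendre (S L) 0) * cos s +
        (legendre L 0 + legendre (S L) 0) * sin s) =
  sqrt 2 * equator_amplitude L * Rabs (sin (s + phi)).
Proof.
assert (Qp : 0 < sqrt 2) by (apply sqrt_lt_R0; lra).
assert (Q : sqrt 2 * sqrt 2 = 2) by (apply sqrt_sqrt; lra).
assert (S4 : forall s, cos s + sin s = sqrt 2 * sin (s + PI / 4)).
{ intros s; rewrite sin_plus, sin_PI4, cos_PI4; field; lra. }
assert (D4 : forall s, sin s - cos s = sqrt 2 * sin (s + - (PI / 4))).
{ intros s; rewrite sin_plus, sin_neg, cos_neg, sin_PI4, cos_PI4; field; lra. }
unfold equator_amplitude.
destruct (legendre_0_bound L) as (Z & _ & _).
apply Rmult_integral in Z; destruct Z as [Z|Z]; rewrite Z.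
- exists (- (PI / 4)); intros s.
  replace (0 ^ 2 + legendre (S L) 0 ^ 2) with (Rsqr (legendre (S L) 0))
    by (unfold Rsqr; ring).
  rewrite sqrt_Rsqr_abs.
  transitivity (Rabs (legendre (S L) 0 * (sin s - cos s))); [f_equal; ring|].
  rewrite D4, !Rabs_mult, (Rabs_pos_eq (sqrt 2)) by lra. ring.
- exists (PI / 4); intros s.
  replace (legendre L 0 ^ 2 + 0 ^ 2) with (Rsqr (legendre L 0))
    by (unfold Rsqr; ring).
  rewrite sqrt_Rsqr_abs.
  transitivity (Rabs (legendre L 0 * (cos s + sin s))); [f_equal; ring|].
  rewrite S4, !Rabs_mult, (Rabs_pos_eq (sqrt 2)) by lra. ring.
Qed.

(** * Integral of the kernel *)

Definition polar_kernel (L : nat) (t : R) : R :=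
  Rabs (sin t * legendre_kernel L (cos t)).

Lemma continuous_polar_kernel (L : nat) (t : R) : continuous (polar_kernel L) t.
Proof.
apply (continuous_comp (fun t => sin t * legendre_kernel L (cos t)) Rabs);
  [|apply continuous_Rabs].
apply (ex_derive_continuous (fun t => sin t * legendre_kernel L (cos t))).
auto_derive. eexists; apply is_derive_legendre_kernel.
Qed.

Lemma ex_RInt_polar_kernel (L : nat) (a b : R) : ex_RInt (polar_kernel L) a b.
Proof.
apply (@ex_RInt_continuous R_CompleteNormedModule); intros.
apply continuous_polar_kernel.
Qed.

Lemma polar_kernel_crude (L : nat) (t : R) : polar_kernel L t <= 2 * INR (S L).
Proof.
pose proof (legendre_kernel_bound L (cos t) (COS_bound t)) as B.
pose proof (pos_INR (S L)).
unfold polar_kernel. rewrite <- (Rabs_pos_eq (2 * INR (S L))) by lra.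
apply Rsqr_le_abs_0. pose proof (sin2_cos2 t) as SC.
rewrite !Rsqr_pow2 in *.
replace ((sin t * legendre_kernel L (cos t)) ^ 2) with
  (sin t ^ 2 * legendre_kernel L (cos t) ^ 2) by ring.
replace (sin t ^ 2) with (1 - cos t ^ 2) by lra.
lra.
Qed.

(** Collects the errors of the averaging and of the sinusoidal approximation on
    [[d, PI-d]], per unit of amplitude; all that matters is that it depends on
    [d] alone. *)
Definition bulk_constant (d : R) : R :=
  4 * sqrt 2 * weight d + 15 / sin d ^ 2 * (sqrt 2 * PI).

(** The leading term is [N * sqrt 2 * w] times the mean [2/PI] of [|sin|] times
    the total weight [sqrt 2 PI], where [w] is the equator amplitude. *)
Lemma polar_kernel_bulk (L : nat) (d : R) :
  0 < d <= PI / 2 -> 1 <= INR (S L) * sin d ->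
  RInt (polar_kernel L) d (PI - d) <=
  4 * (INR (S L) * equator_amplitude L) + equator_amplitude L * bulk_constant d.
Proof.
intros Hd Hs. pose proof PI_RGT_0.
destruct (equator_amplitude_sqr L) as [W0 _].
destruct (equator_phase L) as [phi Hphi].
set (psi := - (INR (S L) * (PI / 2)) + phi).
assert (HN : 0 < INR (S L)) by (apply lt_0_INR; lia).
assert (Sp : 0 < sin d) by (apply sin_gt_0; lra).
assert (Sp2 : 0 < sin d ^ 2) by (apply pow_lt; lra).
assert (Qp : 0 < sqrt 2) by (apply sqrt_lt_R0; lra).
assert (Q : sqrt 2 * sqrt 2 = 2) by (apply sqrt_sqrt; lra).
set (w := equator_amplitude L) in *. set (N := INR (S L)) in *.
assert (P : forall t, d <= t <= PI - d ->
  polar_kernel L t <= N * sqrt 2 * w * (weight t * Rabs (sin (N * t + psi))) +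
                      15 * w / sin d ^ 2 * weight t).
{ intros t Ht.
  assert (Hphase : Rabs (kernel_osc L t - (kernel_osc L (PI / 2) * cos (N * (t - PI / 2))
    + pair_osc L (PI / 2) * sin (N * (t - PI / 2)))) <= 3 * (5 * w) / (N * sin d ^ 2)).
  { apply oscillator_phase; [apply legendre_oscillator|lra|lra|lra|].
    intros u Hu; apply kernel_osc_bound; [lra|]. fold N.
    assert (sin d <= sin u); [|nra].
    destruct (Rle_or_lt u (PI / 2)).
    - apply sin_between; lra.
    - rewrite <- (sin_PI_x d). apply sin_between; lra. }
  destruct (osc_equator L) as (_ & E1 & E2). rewrite E1, E2 in Hphase.
  specialize (Hphi (N * (t - PI / 2))).
  replace (N * (t - PI / 2) + phi) with (N * t + psi) in Hphi by (unfold psi; ring).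
  set (m := (legendre L 0 - legendre (S L) 0) * cos (N * (t - PI / 2)) +
            (legendre L 0 + legendre (S L) 0) * sin (N * (t - PI / 2))) in *.
  assert (T : Rabs (kernel_osc L t) <=
              sqrt 2 * w * Rabs (sin (N * t + psi)) + 3 * (5 * w) / (N * sin d ^ 2)).
  { rewrite <- Hphi. replace (kernel_osc L t) with (m + (kernel_osc L t - m)) by ring.
    eapply Rle_trans; [apply Rabs_triang|]. lra. }
  unfold polar_kernel. rewrite kernel_osc_eq by lra. fold N.
  pose proof (weight_pos t ltac:(lra)).
  apply Rle_trans with (N * weight t *
    (sqrt 2 * w * Rabs (sin (N * t + psi)) + 3 * (5 * w) / (N * sin d ^ 2))).
  - apply Rmult_le_compat_l; [nra|exact T].
  - apply Req_le. field. lra. }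
set (Phi := fun u => 2 / PI * weight_primitive u +
        / N * (weight u * (sin_primitive (N * u + psi) - 2))).
assert (I : RInt (polar_kernel L) d (PI - d) <=
  (N * sqrt 2 * w * Phi (PI - d) + 15 * w / sin d ^ 2 * weight_primitive (PI - d)) -
  (N * sqrt 2 * w * Phi d + 15 * w / sin d ^ 2 * weight_primitive d)).
{ apply (RInt_le_primitive (polar_kernel L) (fun u => N * sqrt 2 * w * Phi u
    + 15 * w / sin d ^ 2 * weight_primitive u)); [lra|apply continuous_polar_kernel|].
  intros t Ht. assert (Ht' : 0 < t < PI) by lra.
  destruct (weight_abs_sin_majorant N psi t HN Ht') as (l & D & B).
  exists (N * sqrt 2 * w * l + 15 * w / sin d ^ 2 * weight t). split.
  - apply @is_derive_plus; apply is_derive_scal; [exact D|].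
    apply is_derive_weight_primitive, Ht'.
  - eapply Rle_trans; [apply P, Ht|]. apply Rplus_le_compat_r, Rmult_le_compat_l; [|exact B].
    repeat apply Rmult_le_pos; lra. }
eapply Rle_trans; [exact I|].
assert (HPhi : Phi (PI - d) - Phi d <= 2 * sqrt 2 + / N * (4 * weight d)).
{ pose proof (weight_total d Hd) as T1.
  assert (2 / PI * (weight_primitive (PI - d) - weight_primitive d) <= 2 * sqrt 2).
  { replace (2 * sqrt 2) with (2 / PI * (sqrt 2 * PI)) by (field; lra).
    apply Rmult_le_compat_l; [apply Rdiv_le_0_compat; lra|exact T1]. }
  assert (weight (PI - d) * (sin_primitive (N * (PI - d) + psi) - 2)
          - weight d * (sin_primitive (N * d + psi) - 2) <= 4 * weight d).
  { pose proof (weight_pos d ltac:(lra)). pose proof (weight_pos (PI - d) ltac:(lra)).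
    pose proof (sin_primitive_bound (N * (PI - d) + psi)) as B1.
    pose proof (sin_primitive_bound (N * d + psi)) as B2.
    apply Rabs_le_between in B1. apply Rabs_le_between in B2. nra. }
  assert (0 < / N) by (apply Rinv_0_lt_compat, HN).
  unfold Phi. nra. }
pose proof (weight_total d Hd) as T1.
assert (A1 : N * sqrt 2 * w * (Phi (PI - d) - Phi d) <=
             N * sqrt 2 * w * (2 * sqrt 2 + / N * (4 * weight d))).
{ apply Rmult_le_compat_l; [repeat apply Rmult_le_pos; lra|exact HPhi]. }
assert (A2 : 15 * w / sin d ^ 2 * (weight_primitive (PI - d) - weight_primitive d) <=
             15 * w / sin d ^ 2 * (sqrt 2 * PI)).
{ apply Rmult_le_compat_l; [apply Rdiv_le_0_compat; lra|exact T1]. }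
replace (N * sqrt 2 * w * (2 * sqrt 2 + / N * (4 * weight d))) with
  (2 * (sqrt 2 * sqrt 2) * N * w + 4 * sqrt 2 * weight d * w) in A1 by (field; lra).
rewrite Q in A1.
unfold bulk_constant.
replace (w * (4 * sqrt 2 * weight d + 15 / sin d ^ 2 * (sqrt 2 * PI))) with
  (4 * sqrt 2 * weight d * w + 15 * w / sin d ^ 2 * (sqrt 2 * PI)) by (field; lra).
lra.
Qed.

Lemma polar_kernel_osc_bound (L : nat) (c t : R) :
  0 < t < PI -> 1 <= INR (S L) * sin t -> weight t <= c ->
  polar_kernel L t <= 5 * (INR (S L) * equator_amplitude L) * c.
Proof.
intros Ht Hs Hc.
destruct (kernel_osc_bound L t Ht Hs) as [B _].
pose proof (weight_pos t Ht). pose proof (pos_INR (S L)).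
destruct (equator_amplitude_sqr L) as [W0 _].
unfold polar_kernel. rewrite kernel_osc_eq by exact Ht.
replace (5 * (INR (S L) * equator_amplitude L) * c) with
  (INR (S L) * c * (5 * equator_amplitude L)) by ring.
apply Rmult_le_compat; [nra|apply Rabs_pos|nra|exact B].
Qed.

Lemma weight_near_0 (t : R) : 0 < t <= 1 -> weight t <= 2 / sqrt t.
Proof.
intros Ht. pose proof (sin_half t ltac:(lra)).
replace (2 / sqrt t) with (sqrt (4 / t)).
- apply sqrt_le_1_alt. pose proof (COS_bound t).
  apply Rle_trans with (2 / sin t).
  + apply Rmult_le_compat_r; [apply Rlt_le, Rinv_0_lt_compat|]; lra.
  + replace (4 / t) with (2 / (t / 2)) by (field; lra).
    apply Rmult_le_compat_l; [lra|apply Rinv_le_contravar; lra].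
- rewrite sqrt_div by lra. replace 4 with (2 * 2) by ring. now rewrite sqrt_square by lra.
Qed.

Lemma weight_near_PI (t : R) : PI / 2 <= t < PI -> weight t <= 1.
Proof.
intros Ht. pose proof PI_RGT_0.
replace t with (PI - (PI - t)) by ring. rewrite weight_reflect by lra.
set (u := PI - t). assert (Hu : 0 < u <= PI / 2) by (unfold u; lra).
rewrite <- Rinv_1. apply Rinv_le_contravar; [lra|].
rewrite <- sqrt_1. apply sqrt_le_1_alt.
assert (0 < sin u) by (apply sin_gt_0; lra).
assert (0 <= cos u) by (apply cos_ge_0; lra).
pose proof (SIN_bound u).
apply (Rmult_le_reg_r (sin u)); [assumption|].
unfold Rdiv; rewrite Rmult_assoc, Rinv_l by lra. lra.
Qed.

(** Cut at [2/N], [d], [PI - d] and [PI - 2/N].  The outermost pieces have length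
    [2/N] and integrand at most [2 N]; on the pieces next to them the integrand
    is at most [5 N w g], where [g <= 2/sqrt t] near [0] and [g <= 1] near [PI]. *)
Lemma polar_kernel_integral (L : nat) (d : R) : 0 < d <= 1 -> 2 <= INR (S L) * d ->
  RInt (polar_kernel L) 0 PI <=
  8 + 25 * (INR (S L) * equator_amplitude L) * sqrt d
    + 4 * (INR (S L) * equator_amplitude L) + equator_amplitude L * bulk_constant d.
Proof.
intros Hd HNd. pose proof PI2_3_2.
destruct (equator_amplitude_sqr L) as [W0 _].
set (N := INR (S L)) in *.
assert (HN : 0 < N) by (apply lt_0_INR; lia).
set (eta := 2 / N).
assert (He : 0 < eta <= d).
{ unfold eta; split; [apply Rdiv_lt_0_compat; lra|].
  apply (Rmult_le_reg_r N); [exact HN|].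
  unfold Rdiv; rewrite Rmult_assoc, Rinv_l; lra. }
assert (Ns : forall t, eta <= t <= 1 -> 1 <= N * sin t).
{ intros t Ht. pose proof (sin_half t ltac:(lra)).
  replace 1 with (N * (eta / 2)) by (unfold eta; field; lra).
  apply Rmult_le_compat_l; lra. }
set (a := N * equator_amplitude L) in *.
assert (Ha : 0 <= a) by (unfold a; apply Rmult_le_pos; lra).
assert (HC := polar_kernel_bulk L d ltac:(lra) (Ns d ltac:(lra))). fold N a in HC.
assert (HA : forall u, RInt (polar_kernel L) u (u + eta) <= 4).
{ intros u. replace 4 with (2 * N * (u + eta) - 2 * N * u) by (unfold eta; field; lra).
  apply (RInt_le_primitive (polar_kernel L) (fun t => 2 * N * t));
    [lra|apply continuous_polar_kernel|].
  intros t _; exists (2 * N); split; [auto_derive; [exact I|ring]|].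
  apply polar_kernel_crude. }
assert (HB : RInt (polar_kernel L) eta d <= 20 * a * sqrt d).
{ apply Rle_trans with (20 * a * sqrt d - 20 * a * sqrt eta).
  - apply (RInt_le_primitive (polar_kernel L) (fun t => 20 * a * sqrt t));
      [lra|apply continuous_polar_kernel|].
    intros t Ht. assert (0 < sqrt t) by (apply sqrt_lt_R0; lra).
    exists (5 * a * (2 / sqrt t)); split.
    + auto_derive; [lra|field; lra].
    + apply polar_kernel_osc_bound; [lra|apply Ns; lra|apply weight_near_0; lra].
  - assert (0 <= a * sqrt eta) by (apply Rmult_le_pos; [exact Ha|apply sqrt_pos]). lra. }
assert (HD : RInt (polar_kernel L) (PI - d) (PI - eta) <= 5 * a * sqrt d).
{ assert (d <= sqrt d).
  { rewrite <- (sqrt_sqrt d) at 1 by lra.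
    assert (sqrt d <= 1) by (rewrite <- sqrt_1; apply sqrt_le_1_alt; lra).
    pose proof (sqrt_pos d). nra. }
  apply Rle_trans with (5 * a * 1 * (PI - eta) - 5 * a * 1 * (PI - d)).
  - apply (RInt_le_primitive (polar_kernel L) (fun t => 5 * a * 1 * t));
      [lra|apply continuous_polar_kernel|].
    intros t Ht. exists (5 * a * 1); split; [auto_derive; [exact I|ring]|].
    apply polar_kernel_osc_bound; [lra| |apply weight_near_PI; lra].
    fold N. rewrite <- sin_PI_x. apply Ns; lra.
  - nra. }
pose proof (ex_RInt_polar_kernel L) as EX.
rewrite <- (RInt_Chasles _ 0 eta PI) by apply EX.
rewrite <- (RInt_Chasles _ eta d PI) by apply EX.
rewrite <- (RInt_Chasles _ d (PI - d) PI) by apply EX.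
rewrite <- (RInt_Chasles _ (PI - d) (PI - eta) PI) by apply EX.
pose proof (HA 0) as HA0. rewrite Rplus_0_l in HA0.
pose proof (HA (PI - eta)) as HA1. replace (PI - eta + eta) with PI in HA1 by ring.
unfold plus; simpl. lra.
Qed.

Lemma polar_substitution (L : nat) :
  RInt (fun x => Rabs (legendre_kernel L x)) (-1) 1 = RInt (polar_kernel L) 0 PI.
Proof.
assert (C : forall x, continuous (fun x => Rabs (legendre_kernel L x)) x).
{ intros x. apply (continuous_comp (legendre_kernel L) Rabs);
    [eapply is_derive_continuous, is_derive_legendre_kernel|apply continuous_Rabs]. }
assert (CC : forall t, continuous
    (fun t => - sin t * Rabs (legendre_kernel L (cos t))) t).
{ intros t. apply (continuous_mult (fun t => - sin t)
    (fun t => Rabs (legendre_kernel L (cos t)))).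
  - apply (continuous_opp sin), continuous_sin.
  - apply (continuous_comp cos (fun x => Rabs (legendre_kernel L x))); [apply continuous_cos|apply C]. }
pose proof PI_RGT_0.
rewrite <- cos_PI, <- cos_0.
rewrite <- (RInt_comp (fun x => Rabs (legendre_kernel L x)) cos (fun t => - sin t)).
- rewrite <- opp_RInt_swap.
  + rewrite <- RInt_opp.
    * apply RInt_ext. rewrite Rmin_left, Rmax_right by lra. intros t Ht.
      unfold polar_kernel. rewrite Rabs_mult, (Rabs_pos_eq (sin t))
        by (apply sin_ge_0; lra).
      unfold opp, scal; simpl; unfold mult; simpl; ring.
    * apply (@ex_RInt_continuous R_CompleteNormedModule); intros t _; apply CC.
  + apply (@ex_RInt_continuous R_CompleteNormedModule); intros t _; apply CC.
- intros; apply C.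
- intros x _; split; [apply is_derive_cos|apply (continuous_opp sin), continuous_sin].
Qed.

Definition leading_constant : R := Rpower 2 (3 / 2) / sqrt PI.

Lemma leading_constant_eq : leading_constant = 2 * sqrt (2 / PI).
Proof.
pose proof PI_RGT_0. unfold leading_constant.
replace (3 / 2) with (1 + / 2) by field.
rewrite Rpower_plus, Rpower_1, Rpower_sqrt, sqrt_div by lra.
field. apply Rgt_not_eq, sqrt_lt_R0; lra.
Qed.

Lemma equator_amplitude_bound (L : nat) :
  equator_amplitude L <= 2 /\
  INR (S L) * equator_amplitude L <= sqrt (2 / PI) * sqrt (INR L) + 2.
Proof.
pose proof PI2_3_2.
assert (P : 0 < 2 / PI <= 1).
{ split; [apply Rdiv_lt_0_compat; lra|].
  apply (Rmult_le_reg_r PI); [lra|]. unfold Rdiv; rewrite Rmult_assoc, Rinv_l; lra. }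
destruct L as [|L].
- unfold equator_amplitude; simpl.
  replace (1 * (1 * 1) + 0 * (0 * 1)) with 1 by ring. rewrite sqrt_0, sqrt_1. lra.
- destruct (equator_amplitude_sqr (S L)) as [W0 W].
  pose proof (legendre_0_energy L) as E. rewrite <- W in E.
  set (w := equator_amplitude (S L)) in *.
  rewrite (S_INR (S L)).
  assert (N1 : 1 <= INR (S L)) by (rewrite S_INR; pose proof (pos_INR L); lra).
  set (m := INR (S L)) in *.
  pose proof (pow2_ge_0 w).
  assert (Wle : w <= 1).
  { apply Rsqr_incr_0; [rewrite !Rsqr_pow2|exact W0|lra]. nra. }
  split; [lra|].
  assert (S1 : 1 <= sqrt m) by (rewrite <- sqrt_1; apply sqrt_le_1_alt, N1).
  assert (Sm : sqrt m * sqrt m = m) by (apply sqrt_sqrt; lra).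
  assert (K : sqrt m * w <= sqrt (2 / PI)).
  { rewrite <- (sqrt_square w) by exact W0. rewrite <- sqrt_mult by nra.
    apply sqrt_le_1_alt. simpl in E. rewrite Rmult_1_r in E. exact E. }
  replace ((m + 1) * w) with (sqrt m * (sqrt m * w) + w) by (rewrite <- Sm at 3; ring).
  nra.
Qed.

Definition unweighted_constant (L : nat) : R :=
  / 2 * RInt (fun x => Rabs (legendre_kernel L x)) (-1) 1.

(** The error next to the end points is a multiple of [sqrt (d L)], so [d] is
    chosen as a small multiple of [eps^2]; everything else is bounded once [d] is
    fixed.  The finitely many [L] with [N d < 2] go into the constant. *)
Lemma unweighted_asymptotics (eps : R) : 0 < eps ->
  exists C, 0 <= C /\ forall L : nat,
    unweighted_constant L <= (leading_constant + eps) * sqrt (INR L) + C.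
Proof.
intros He. pose proof PI_RGT_0. pose proof PI2_3_2. pose proof PI_4.
(* Half of the 25 in front of [sqrt d] is below 13. *)
set (s := Rmin 1 (eps / 13)).
assert (Hs : 0 < s) by (apply Rmin_glb_lt; lra).
assert (Hs1 : s <= 1) by apply Rmin_l.
assert (Hs2 : s <= eps / 13) by apply Rmin_r.
set (d := s * s). assert (Hd : 0 < d <= 1) by (unfold d; nra).
assert (Sd : sqrt d = s) by (apply sqrt_square; lra).
set (B := Rabs (bulk_constant d)).
assert (HB : 0 <= B) by apply Rabs_pos.
assert (P1 : sqrt (2 / PI) <= 1).
{ rewrite <- sqrt_1; apply sqrt_le_1_alt.
  apply (Rmult_le_reg_r PI); [lra|]. unfold Rdiv; rewrite Rmult_assoc, Rinv_l; lra. }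
assert (P0 : 0 <= sqrt (2 / PI)) by apply sqrt_pos.
assert (D0 : 0 < 2 / d) by (apply Rdiv_lt_0_compat; lra).
exists (33 + B + 4 * (2 / d)); split; [lra|]. intros L.
unfold unweighted_constant. rewrite polar_substitution, leading_constant_eq.
pose proof (sqrt_pos (INR L)) as SL.
destruct (Rle_or_lt 2 (INR (S L) * d)) as [Hbig|Hsmall].
- pose proof (polar_kernel_integral L d Hd Hbig) as I. rewrite Sd in I.
  destruct (equator_amplitude_bound L) as [W2 NW].
  destruct (equator_amplitude_sqr L) as [W0 _].
  set (a := INR (S L) * equator_amplitude L) in *.
  assert (equator_amplitude L * bulk_constant d <= 2 * B).
  { pose proof (Rle_abs (bulk_constant d)). fold B in H2. nra. }
  assert (a * s <= eps / 13 * sqrt (INR L) + 2).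
  { apply Rle_trans with ((sqrt (INR L) + 2) * s); [apply Rmult_le_compat_r; nra|nra]. }
  assert (0 <= eps * sqrt (INR L)) by (apply Rmult_le_pos; lra). lra.
- assert (I : RInt (polar_kernel L) 0 PI <= 2 * INR (S L) * PI - 2 * INR (S L) * 0).
  { apply (RInt_le_primitive (polar_kernel L) (fun t => 2 * INR (S L) * t));
      [lra|apply continuous_polar_kernel|].
    intros t _; exists (2 * INR (S L)); split; [|apply polar_kernel_crude].
    generalize (INR (S L)); intros; auto_derive; [exact I|ring]. }
  assert (INR (S L) < 2 / d).
  { apply (Rmult_lt_reg_r d); [lra|]. unfold Rdiv; rewrite Rmult_assoc, Rinv_l; lra. }
  assert (0 <= (2 * sqrt (2 / PI) + eps) * sqrt (INR L)) by (apply Rmult_le_pos; lra).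
  pose proof (pos_INR (S L)). nra.
Qed.

(** * Summation by parts *)

Definition filter_coef (lambda : R) (mu : nat -> R) (l : nat) : R :=
  / (1 + lambda * mu l ^ 2).

Lemma mu_nonneg (mu : nat -> R) : 0 <= mu 0%nat ->
  (forall l, mu l <= mu (S l)) -> forall l, 0 <= mu l.
Proof. intros H0 Hm l; induction l as [|l IH]; [exact H0|]. specialize (Hm l); lra. Qed.

Lemma filter_coef_decreasing (lambda : R) (mu : nat -> R) :
  0 <= lambda -> 0 <= mu 0%nat -> (forall l, mu l <= mu (S l)) ->
  forall l, 0 < filter_coef lambda mu (S l) <= filter_coef lambda mu l.
Proof.
intros Hl H0 Hm l. pose proof (mu_nonneg mu H0 Hm l). specialize (Hm l).
assert (mu l ^ 2 <= mu (S l) ^ 2) by (apply pow_incr; lra).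
pose proof (pow2_ge_0 (mu l)).
assert (0 <= lambda * mu l ^ 2) by (apply Rmult_le_pos; lra).
assert (lambda * mu l ^ 2 <= lambda * mu (S l) ^ 2) by (apply Rmult_le_compat_l; lra).
split; [apply Rinv_0_lt_compat|apply Rinv_le_contravar]; lra.
Qed.

Lemma min_upto_nondecreasing (mu : nat -> R) :
  (forall l, mu l <= mu (S l)) -> forall L, min_upto mu L = mu 0%nat.
Proof.
intros Hm.
assert (M : forall l, mu 0%nat <= mu l).
{ induction l as [|l IH]; [lra|]. specialize (Hm l); lra. }
induction L as [|L IH]; [reflexivity|].
change (Rmin (min_upto mu L) (mu (S L)) = mu 0%nat).
rewrite IH. apply Rmin_left, M.
Qed.

Lemma continuous_legendre_kernel (L : nat) (x : R) : continuous (legendre_kernel L) x.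
Proof. eapply is_derive_continuous, is_derive_legendre_kernel. Qed.

Lemma RInt_abs_comb (f g : R -> R) (c : R) (a b : R) : a <= b -> 0 <= c ->
  (forall x, continuous f x) -> (forall x, continuous g x) ->
  RInt (fun x => Rabs (f x + c * g x)) a b <=
  RInt (fun x => Rabs (f x)) a b + c * RInt (fun x => Rabs (g x)) a b.
Proof.
intros Hab Hc Hf Hg.
assert (CA : forall h : R -> R, (forall x, continuous h x) ->
  ex_RInt (fun x => Rabs (h x)) a b).
{ intros h Hh. apply (@ex_RInt_continuous R_CompleteNormedModule); intros x _.
  apply (continuous_comp h Rabs); [apply Hh|apply continuous_Rabs]. }
assert (Cg : forall x, continuous (fun x => c * g x) x).
{ intros x. apply (continuous_scal_r c g), Hg. }
assert (E : is_RInt (fun x => Rabs (f x) + c * Rabs (g x)) a b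
  (RInt (fun x => Rabs (f x)) a b + c * RInt (fun x => Rabs (g x)) a b)).
{ apply (is_RInt_plus (V := R_NormedModule)).
  - apply (@RInt_correct R_CompleteNormedModule), CA, Hf.
  - apply (is_RInt_scal (V := R_NormedModule)).
    apply (@RInt_correct R_CompleteNormedModule), CA, Hg. }
rewrite <- (is_RInt_unique _ _ _ _ E).
apply RInt_le; [exact Hab| |eexists; exact E|].
- apply CA; intros x. apply (continuous_plus f (fun x => c * g x)); [apply Hf|apply Cg].
- intros x _. eapply Rle_trans; [apply Rabs_triang|].
  rewrite Rabs_mult, (Rabs_pos_eq c) by exact Hc. lra.
Qed.

(** The filtered kernel minus [c_L K_L] increases by [(c_L - c_(L+1)) K_L] when
    the degree goes from [L] to [L+1], so half the integral of its
    absolute value is at most [(c_0 - c_L) B]. *)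
Lemma lebesgue_constant_abel (lambda : R) (mu : nat -> R) (m : nat) (B : R) :
  0 <= lambda -> 0 <= mu 0%nat -> (forall l, mu l <= mu (S l)) ->
  (forall l, (l <= m)%nat -> unweighted_constant l <= B) ->
  lebesgue_constant lambda mu m <= filter_coef lambda mu 0 * B.
Proof.
intros Hl H0 Hm HB.
set (c := filter_coef lambda mu).
assert (Hc : forall l, 0 < c (S l) <= c l) by (apply filter_coef_decreasing; assumption).
set (T := fun L x => kernel lambda mu L x - c L * legendre_kernel L x).
assert (T0 : forall x, T 0%nat x = 0).
{ intros x; unfold T, kernel, legendre_kernel, c, filter_coef; simpl.
  unfold Rdiv; ring. }
assert (TS : forall L x, T (S L) x = T L x + (c L - c (S L)) * legendre_kernel L x).
{ intros L x; unfold T, kernel, legendre_kernel. rewrite !tech5.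
  unfold Rdiv. fold (filter_coef lambda mu (S L)). fold c. ring. }
assert (P : forall L, (L <= m)%nat -> (forall x, continuous (T L) x) /\
  / 2 * RInt (fun x => Rabs (T L x)) (-1) 1 <= (c 0%nat - c L) * B).
{ induction L as [|L IH]; intros HL.
  - split.
    + intros x. apply (continuous_ext (fun _ => 0)); [intros; now rewrite T0|].
      apply continuous_const.
    + rewrite (RInt_ext _ (fun _ => 0)).
      * rewrite RInt_const. unfold scal; simpl; unfold mult; simpl. lra.
      * intros x _. now rewrite T0, Rabs_R0.
  - destruct IH as [IC IB]; [lia|]. specialize (Hc L). split.
    + intros x. apply (continuous_ext (fun x => T L x + (c L - c (S L)) * legendre_kernel L x));
        [intros; now rewrite TS|].
      apply (continuous_plus (T L) (fun x => (c L - c (S L)) * legendre_kernel L x));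
        [apply IC|].
      apply (continuous_scal_r (c L - c (S L)) (legendre_kernel L)),
        continuous_legendre_kernel.
    + rewrite (RInt_ext _ (fun x => Rabs (T L x + (c L - c (S L)) * legendre_kernel L x)))
        by (intros; now rewrite TS).
      pose proof (RInt_abs_comb (T L) (legendre_kernel L) (c L - c (S L)) (-1) 1
        ltac:(lra) ltac:(lra) IC (continuous_legendre_kernel L)) as I.
      pose proof (HB L ltac:(lia)) as U; unfold unweighted_constant in U.
      nra. }
destruct (P m (le_n m)) as [IC IB].
assert (cm : 0 < c m).
{ specialize (Hc m); lra. }
unfold lebesgue_constant.
rewrite (RInt_ext _ (fun x => Rabs (T m x + c m * legendre_kernel m x)))
  by (intros x _; f_equal; unfold T; ring).
pose proof (RInt_abs_comb (T m) (legendre_kernel m) (c m) (-1) 1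
  ltac:(lra) ltac:(lra) IC (continuous_legendre_kernel m)) as I.
pose proof (HB m (le_n m)) as U; unfold unweighted_constant in U.
nra.
Qed.

(** * The Lebesgue constants *)

Theorem theorem3p2 (f : R -> R)
    (hf : continuous_on (fun x => -1 <= x <= 1) f)
    (lambda : R) (hlambda : 0 <= lambda)
    (mu : nat -> R) (hmu0 : 0 <= mu 0%nat)
    (hmu : forall l : nat, mu l <= mu (S l)) :
  exists r : nat -> R,
    is_domin eventually (fun L : nat => sqrt (INR L)) r /\
    forall L : nat, (2 <= L)%nat ->
      lebesgue_constant lambda mu L <=
        1 / (1 + lambda * (min_upto mu L) ^ 2) *
        (Rpower 2 (3 / 2) / sqrt PI * sqrt (INR L) + r L).
Proof.
set (D := 1 + lambda * mu 0%nat ^ 2).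
assert (HD : 0 < D).
{ unfold D. pose proof (Rmult_le_pos _ _ hlambda (pow2_ge_0 (mu 0%nat))). lra. }
(* The remainder is the positive part of what it has to dominate. *)
exists (fun L => Rmax 0 (D * lebesgue_constant lambda mu L -
                         leading_constant * sqrt (INR L))).
split.
- intros eps. pose proof (cond_pos eps) as He.
  destruct (unweighted_asymptotics (eps / 2) ltac:(lra)) as (C & HC & HU).
  destruct (INR_unbounded ((2 * C / eps) ^ 2)) as [n Hn].
  exists n; intros L HL.
  assert (B : D * lebesgue_constant lambda mu L <=
              (leading_constant + eps / 2) * sqrt (INR L) + C).
  { assert (K0 : 0 <= leading_constant).
    { rewrite leading_constant_eq. pose proof (sqrt_pos (2 / PI)); lra. }
    pose proof (lebesgue_constant_abel lambda mu L
      ((leading_constant + eps / 2) * sqrt (INR L) + C) hlambda hmu0 hmu) as A.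
    unfold filter_coef in A. fold D in A.
    apply (Rmult_le_reg_l (/ D)); [apply Rinv_0_lt_compat, HD|].
    rewrite <- Rmult_assoc, Rinv_l, Rmult_1_l by lra. apply A.
    intros l Hl. eapply Rle_trans; [apply HU|].
    apply Rplus_le_compat_r, Rmult_le_compat_l; [lra|].
    apply sqrt_le_1_alt, le_INR, Hl. }
  assert (S : 2 * C / eps <= sqrt (INR L)).
  { assert (0 <= 2 * C / eps) by (apply Rdiv_le_0_compat; lra).
    rewrite <- (sqrt_pow2 (2 * C / eps)) by assumption.
    apply sqrt_le_1_alt. apply le_INR in HL. lra. }
  assert (S' : C <= eps / 2 * sqrt (INR L)).
  { replace C with (eps / 2 * (2 * C / eps)) by (field; lra).
    apply Rmult_le_compat_l; lra. }
  pose proof (sqrt_pos (INR L)).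
  unfold norm; simpl; unfold abs; simpl.
  rewrite (Rabs_pos_eq (sqrt (INR L))) by assumption.
  rewrite Rabs_pos_eq by apply Rmax_l.
  apply Rmax_lub; [apply Rmult_le_pos; lra|lra].
- intros L _. rewrite min_upto_nondecreasing by exact hmu. fold D.
  fold leading_constant.
  pose proof (Rmax_r 0 (D * lebesgue_constant lambda mu L -
                        leading_constant * sqrt (INR L))).
  apply (Rmult_le_reg_l D); [exact HD|].
  rewrite <- Rmult_assoc. replace (D * (1 / D)) with 1 by (field; lra). lra.
Qed.
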